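(* Assume the Generalized Continuum Hypothesis. Let $X$ be an infinite zero-dimensional Tychonoff space. Then $C_p(X)$ has a point-separating discrete subspace if and only if $s(X^n)\geq iw(X)$ for some natural number $n$.
   Context: $C_p(X)$ is the space of all continuous functions $X\to\mathbb{R}$ with the topology of pointwise convergence. A set $F\subset C_p(X)$ is point-separating if for any distinct $x,y\in X$ there is $f\in F$ with $f(x)\neq f(y)$. A discrete subspace is a subset that is discrete in its subspace topology; it need not be closed. For a space $Z$, $s(Z)$ (spread) is the supremum of the cardinalities of discrete subspaces of $Z$. $iw(X)$ is the smallest weight of a Tychonoff topology on $X$ contained in (possibly equal to) the topology of $X$. Zero-dimensional means $\dim X=0$ (covering dimension for Tychonoff spaces: every finite cover by functionally open sets has a finite refinement that is a cover by pairwise disjoint clopen sets). *)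

(* Defs.v *)
From mathcomp Require Import all_boot all_order all_algebra.
From mathcomp Require Import all_classical all_reals all_analysis.

Set Implicit Arguments.
Unset Strict Implicit.
Unset Printing Implicit Defensive.

Import numFieldNormedType.Exports.

Local Open Scope classical_set_scope.
Local Open Scope card_scope.
Local Open Scope ring_scope.

Definition GCH : Prop := forall T U : Type,
  infinite_set [set: T] ->
  [set: T] #<= [set: U] -> [set: U] #<= [set: set T] ->
  [set: U] #= [set: T] \/ [set: U] #= [set: set T].

Definition tychonoff_space (T : topologicalType) : Prop :=
  hausdorff_space T /\ completely_regular_space T.

Definition functionally_open (R : realType) (T : topologicalType)
    (U : set T) : Prop :=
  exists2 f : T -> R, continuous f & U = [set x | f x != 0].

(* Covering dimension zero; this differs from the library's zero_dimensional,
   which only asks for clopen sets separating points. *)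
Definition covering_dim0 (R : realType) (T : topologicalType) : Prop :=
  forall UU : set (set T), finite_set UU ->
    (forall U, UU U -> functionally_open R U) -> cover UU id = [set: T] ->
  exists VV : set (set T),
    [/\ finite_set VV, VV `<=` clopen, trivIset VV id, cover VV id = [set: T] &
        forall V, VV V -> exists2 U, UU U & V `<=` U].

Definition discrete_subspace (T : topologicalType) (D : set T) : Prop :=
  D `<=` isolated D.

(* A type K stands for the cardinal of [set: K]; the cardinal invariants below
   are relations, each determining K up to equipotence. *)

Definition is_spread (T : topologicalType) (K : Type) : Prop :=
  (forall D : set T, discrete_subspace D -> D #<= [set: K]) /\
  (forall L : Type, (forall D : set T, discrete_subspace D -> D #<= [set: L]) ->
     [set: K] #<= [set: L]).

Definition is_weight (T : topologicalType) (K : Type) : Prop :=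
  (exists2 B : set (set T), basis B & B #= [set: K]) /\
  (forall B : set (set T), basis B -> [set: K] #<= B).

(* An element of [Topological.axioms_ X] is a topology on the carrier of [X],
   in general different from the canonical one. *)
Definition coarser_tychonoff (X : topologicalType) (c : Topological.axioms_ X) :
    Prop :=
  let Y := Topological.Pack c in
  (@open Y `<=` @open X) /\ tychonoff_space Y.

Definition is_iw (X : topologicalType) (K : Type) : Prop :=
  (exists2 c : Topological.axioms_ X,
     coarser_tychonoff c & is_weight (Topological.Pack c) K) /\
  (forall (c : Topological.axioms_ X) (L : Type),
     coarser_tychonoff c -> is_weight (Topological.Pack c) L ->
     [set: K] #<= [set: L]).

Definition Cp (R : realType) (X : topologicalType) : topologicalType :=
  initial_topology (fun f : continuousType X R => (f : {ptws X -> R})).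

Definition point_separating (R : realType) (X : topologicalType)
    (F : set (Cp R X)) : Prop :=
  forall x y : X, x != y ->
    exists2 f : continuousType X R, F f & f x != f y.

(* Main.v *)
Require Import Defs.
From mathcomp Require Import all_boot all_order all_algebra.
From mathcomp Require Import all_classical all_reals all_analysis.
From mathcomp Require Import lra wochoice.

(** Let I be the cardinal iw(X). The theorem is reduced to the existence of a
    discrete set of size at least I in some finite power of X.

    The key is [discrete_square]: X^2 contains an infinite discrete set D with
    I <= 2^(2^D). Indeed Shapirovskii's lemma, applied to the clopen rectangles
    C * ~C that cover the complement of the diagonal, gives a discrete D such that
    the rectangles chosen at the points of the closure of D suffice to separate the
    points of X; the closure of D has at most 2^(2^D) points, and the weight of the
    topology generated by a family of clopen sets is bounded by the family. Hence
    either I <= D, or D < I <= 2^(2^D) and GCH yields I = 2^M with M infinite, in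
    which case every cardinal below I is at most M ([discrete_square_gch]). In the
    first case X^2 already has a large discrete set, and the second case is free of
    any difficulty about suprema or cofinalities.

    Suppose that F is a point-separating discrete set in C_p(X), and that no finite
    power of X has spread at least I. Then I = 2^M and all the spreads are at most
    M. Since F is a countable union of sets that inject into discrete sets of finite
    powers ([discrete_Cp_pieces]), F is at most M too, and I <= M because F separates
    points ([iw_le_separating]). This contradicts Cantor's theorem.

    Conversely, suppose that s(X^n) >= I and that I = 2^M. If all discrete sets of
    X^n were smaller than I, they would be at most M, and so would be s(X^n). So in
    either case some finite power has a discrete set D of size at least I. A coarser topology of weight I
    provides a family of I clopen sets separating points ([separating_clopens]), and
    [discrete_Cp_of_discrete_power] encodes the isolating boxes of the points of D
    and these clopen sets into integer-valued functions.

    The cardinal arithmetic needed (comparability and well-ordering of cardinals,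
    the square of an infinite cardinal) is derived from Zorn's lemma. *)

Set Implicit Arguments.
Unset Strict Implicit.
Unset Printing Implicit Defensive.

Import Order.TTheory GRing.Theory Num.Theory.
Import numFieldNormedType.Exports.

Local Open Scope classical_set_scope.
Local Open Scope card_scope.

(** * Cardinal arithmetic *)

Lemma card_leTP (T U : Type) :
  [set: T] #<= [set: U] <-> exists f : T -> U, injective f.
Proof.
split=> [/card_leP[f]|[f finj]].
  exists (fun x => val (f (SigSub (mem_set (I : [set: T] x))))) => x y /val_inj e.
  have /(congr1 val)// : SigSub (mem_set (I : [set: T] x)) =
      SigSub (mem_set (I : [set: T] y)).
  by apply: (@inj _ _ setT f) => //; rewrite inE.
have [_ h] := @injfunPex T U setT setT.
by apply: inj_card_le; have/unsquash := h (ex_intro2 _ _ f (fun _ _ => I) (in2W finj)).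
Qed.

Lemma card_le_funP (T U : Type) (A : set T) (u : U) :
  A #<= [set: U] <->
  exists f : T -> U, forall x y, A x -> A y -> f x = f y -> x = y.
Proof.
split=> [|[f finj]].
  rewrite -(card_le_eql (card_setT A)) => /card_leTP[f finj].
  exists (fun x => if pselect (A x) is left Ax then f (SigSub (mem_set Ax)) else u).
  move=> x y Ax Ay; case: pselect => // Ax'; case: pselect => // Ay'.
  by move=> /finj/(congr1 val).
rewrite -(card_le_eql (card_setT A)); apply/card_leTP.
exists (fun x : A => f (val x)) => x y /finj e; apply: val_inj; apply: e.
  exact: set_valP.
exact: set_valP.
Qed.

(** Cardinals are well ordered. In the product of the family, a maximal set of
    choice functions that pairwise differ at every index must project onto some
    factor, since otherwise one could adjoin a function avoiding all of its
    projections; that factor then injects into all the others. *)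
Lemma least_card (I : Type) (i0 : I) (A : I -> Type) :
  exists i, forall j, [set: A i] #<= [set: A j].
Proof.
pose P (M : set (forall i, A i)) :=
  forall m m' i, M m -> M m' -> m i = m' i -> m = m'.
have [F FP Ftot|M [PM maxM]] := @Zorn_bigcup (forall i, A i) P.
  move=> m m' i [X FX Xm] [Y FY Ym'].
  have [XY|YX] := Ftot _ _ FX FY.
    by apply: (FP _ FY) => //; exact: XY.
  by apply: (FP _ FX) => //; exact: YX.
have [[i onto]|/forallNP nonto] :=
    pselect (exists i, forall a : A i, exists2 m, M m & m i = a).
  exists i => j; have {}onto a : {m | M m /\ m i = a}.
    by apply: cid; have [m Mm ma] := onto a; exists m.
  apply/card_leTP; exists (fun a => sval (onto a) j) => a b.
  have [Ma ea] := svalP (onto a); have [Mb eb] := svalP (onto b).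
  by move=> ab; rewrite -ea -eb (PM _ _ _ Ma Mb ab).
have {}nonto i : {a : A i | forall m, M m -> m i <> a}.
  apply: cid; apply: contrapT => /forallNP H; apply: (nonto i) => a.
  by apply: contrapT => /forall2NP Ha; apply: (H a) => m Mm ma; case: (Ha m).
pose n i := sval (nonto i).
have nM m i : M m -> m i <> n i by move=> Mm; apply: (svalP (nonto i)).
have MnM : M `<` (M `|` [set n]).
  split; first by move=> m; left.
  by move=> /(_ n (or_intror erefl)) Mn; exact: (nM n i0).
have [] := maxM _ MnM => m m' i [Mm|->] [Mm'|->] // e; first exact: PM e.
  by case: (nM m i).
by case: (nM m' i).
Qed.

Lemma card_le_total (T U : Type) :
  ([set: T] #<= [set: U]) \/ ([set: U] #<= [set: T]).
Proof.
have [b H] := @least_card bool true (fun b => if b then T else U).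
by case: b H => H; [left; exact: (H false)|right; exact: (H true)].
Qed.

Lemma card_nle_ge (T U : Type) : ~ ([set: T] #<= [set: U]) -> [set: U] #<= [set: T].
Proof. by case: (card_le_total T U). Qed.

Lemma infinite_natP (T : Type) :
  infinite_set [set: T] <-> exists f : nat -> T, injective f.
Proof. by rewrite infiniteP card_leTP. Qed.

Section PairingFunction.
Variables (T : Type) (N : nat -> T).
Hypothesis Ninj : injective N.

(** The injections are total functions on T, constrained on [pdom] only, which
    spares the dependent type of functions on a varying domain. *)
Record pairing := Pairing {
  pdom : set T;
  pfun : T -> T -> T;
  pdomN : forall n, pdom (N n);
  pfun_dom : forall x y, pdom x -> pdom y -> pdom (pfun x y);
  pfun_inj : forall x y x' y', pdom x -> pdom y -> pdom x' -> pdom y' ->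
    pfun x y = pfun x' y' -> x = x' /\ y = y' }.

Definition pairing_le (p q : pairing) := `[< pdom p `<=` pdom q /\
  forall x y, pdom p x -> pdom p y -> pfun p x y = pfun q x y >].

Lemma pairing0 : inhabited pairing.
Proof.
have Nrange x : range N x -> {n | N n = x} by move=> Nx; apply: cid; case: Nx => n; exists n.
pose inv x := if pselect (range N x) is left h then sval (Nrange x h) else 0.
have invK n : inv (N n) = n.
  rewrite /inv; case: pselect => [h|[]]; last by exists n.
  by apply: Ninj; exact: svalP (Nrange _ h).
exists; exists (range N) (fun x y => N (pickle (inv x, inv y))).
- by move=> n; exists n.
- by move=> x y _ _; exists (pickle (inv x, inv y)).
move=> _ _ _ _ [a _ <-] [b _ <-] [a' _ <-] [b' _ <-]; rewrite !invK.
by move=> /Ninj/(pcan_inj pickleK)[-> ->].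
Qed.

(** Zorn's lemma on injections of A * A into A, for subsets A of T that contain
    the range of N. Injections are compared on the smaller domain only, so the
    order is a preorder. *)
Lemma pairing_max : exists p, forall q, pairing_le p q -> pairing_le q p.
Proof.
have [p0] := pairing0.
apply: (ZL_preorder p0) => [p|p q r|].
- by apply/asboolP; split.
- move=> /asboolP[qp Eqp] /asboolP[pr Epr]; apply/asboolP; split.
    exact: subset_trans pr.
  by move=> x y qx qy; rewrite Eqp// Epr//; exact: qp.
move=> C Ctot; have [[c Cc]|/forallNP C0] := pselect (exists c, C c); last first.
  by exists p0 => s /C0.
pose D : set T := \bigcup_(q in C) pdom q.
pose Q x y q := [/\ C q, pdom q x & pdom q y].
pose f x y := if pselect (exists q, Q x y q) is left h
  then pfun (sval (cid h)) x y else x.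
have common q r : C q -> C r -> exists s, [/\ C s, pdom q `<=` pdom s,
    pdom r `<=` pdom s, (forall x y, pdom q x -> pdom q y -> pfun q x y = pfun s x y)
    & (forall x y, pdom r x -> pdom r y -> pfun r x y = pfun s x y)].
  move=> Cq Cr; have [/asboolP[? ?]|/asboolP[? ?]] := Ctot _ _ Cq Cr.
    by exists r; split=> //.
  by exists q; split=> //.
have fE q x y : Q x y q -> f x y = pfun q x y.
  move=> [Cq qx qy]; rewrite /f; case: pselect => [h|[]]; last by exists q.
  case: (cid h) => r /= [Cr rx ry].
  by have [s [Cs _ _ Eq Er]] := common _ _ Cq Cr; rewrite Eq// Er.
have DD x y : D x -> D y -> exists q, Q x y q.
  move=> [q Cq qx] [r Cr ry]; have [s [Cs qs rs _ _]] := common _ _ Cq Cr.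
  by exists s; split; [|exact: qs|exact: rs].
have DN n : D (N n) by exists c => //; exact: pdomN.
have Df x y : D x -> D y -> D (f x y).
  move=> Dx Dy; have [q Qq] := DD _ _ Dx Dy; rewrite (fE _ _ _ Qq).
  by case: Qq => Cq qx qy; exists q => //; exact: pfun_dom.
have finj x y x' y' : D x -> D y -> D x' -> D y' -> f x y = f x' y' ->
    x = x' /\ y = y'.
  move=> Dx Dy Dx' Dy'; have [q [Cq qx qy]] := DD _ _ Dx Dy.
  have [r [Cr rx ry]] := DD _ _ Dx' Dy'.
  have [s [Cs qs rs _ _]] := common _ _ Cq Cr.
  rewrite (fE s x y) ?(fE s x' y'); [|by split; auto..].
  by apply: pfun_inj; auto.
exists (Pairing DN Df finj) => q Cq; apply/asboolP; split=> /=.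
  by move=> x qx; exists q.
by move=> x y qx qy; rewrite (fE q).
Qed.

(** For a maximal domain A, either the complement of A injects into A, and then T
    itself injects into A (two disjoint copies of A fit into A * A); or a copy B
    of A fits outside A, and the pairs that meet B can be sent to B, which
    contradicts maximality. *)
Lemma pairing_injection : exists f : T * T -> T, injective f.
Proof.
have [p maxp] := pairing_max.
set A := pdom p.
suff [j jinj] : exists j : T -> A, injective j.
  exists (fun xy => pfun p (val (j xy.1)) (val (j xy.2))) => -[x y] [x' y'] /=.
  move=> /pfun_inj[]; try exact: set_valP.
  by move=> /val_inj/jinj-> /val_inj/jinj->.
have NA n : A (N n) := pdomN p n.
pose a0 : A := SigSub (mem_set (NA 0)).
have [/card_leTP[j jinj]|/card_leTP[h hinj]] := card_le_total (~` A) A.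
  pose k x := if pselect (A x) is left Ax then
    pfun p (N 0) x else if pselect ((~` A) x) is left nAx then
      pfun p (N 1) (val (j (SigSub (mem_set nAx)))) else N 0.
  have kA x : A (k x).
    rewrite /k; case: pselect => Ax; first by apply: pfun_dom => //; exact: NA.
    by case: pselect => // nAx; apply: pfun_dom; [exact: NA|exact: set_valP].
  exists (fun x => SigSub (mem_set (kA x))) => x y /(congr1 val) /=.
  rewrite /k; case: (pselect (A x)) => Ax; case: (pselect (A y)) => Ay.
  - by move=> /pfun_inj[] //; exact: NA.
  - case: pselect => // nAy /pfun_inj[]//; [exact: NA|exact: NA|exact: set_valP|].
    by move/Ninj.
  - case: pselect => // nAx /pfun_inj[]//; [exact: NA|exact: set_valP|exact: NA|].
    by move/Ninj.
  case: pselect => // nAx; case: pselect => // nAy /pfun_inj[].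
  - exact: NA.
  - exact: set_valP.
  - exact: NA.
  - exact: set_valP.
  by move=> _ /val_inj/jinj/(congr1 val).
(* Second case: h copies A onto a disjoint set B, and the domain grows to D. *)
exfalso.
pose B : set T := range (fun a => val (h a)).
have BA x : B x -> ~ A x by move=> [a _ <-]; exact: (set_valP (h a)).
have Bpre x : B x -> {a | val (h a) = x}.
  by move=> Bx; apply: cid; case: Bx => a _; exists a.
pose base x : T := if pselect (B x) is left Bx then val (sval (Bpre x Bx)) else x.
have baseA x : A x \/ B x -> A (base x).
  rewrite /base; case: pselect => Bx; first by move=> _; exact: set_valP.
  by case.
have baseB a : base (val (h a)) = val a.
  rewrite /base; case: pselect => [Bx|[]]; last by exists a.
  by congr val; apply: hinj; apply: val_inj; exact: svalP (Bpre _ Bx).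
have baseI x : A x -> base x = x.
  by move=> Ax; rewrite /base; case: pselect => // Bx; case: (BA _ Bx).
have base_inj x y : A x \/ B x -> A y \/ B y -> (A x <-> A y) ->
    base x = base y -> x = y.
  move=> [Ax|Bx] [Ay|By] AxAy.
  - by rewrite !baseI.
  - by case: (BA _ By); apply/AxAy.
  - by case: (BA _ Bx); apply/AxAy.
  by move: Bx By => [a _ <-] [b _ <-]; rewrite !baseB => /val_inj ->.
(* The tag remembers which of the two coordinates lie in A, and with it the
   bases determine the pair. *)
pose tag x y := N (pickle (`[< A x >], `[< A y >])).
have tag_inj x y x' y' : tag x y = tag x' y' -> (A x <-> A x') /\ (A y <-> A y').
  move=> /Ninj/(pcan_inj pickleK)[e e'].
  by rewrite -(asboolE (A x)) e asboolE -(asboolE (A y)) e' asboolE.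
pose code x y : T := pfun p (tag x y) (pfun p (base x) (base y)).
have codeA x y : A x \/ B x -> A y \/ B y -> A (code x y).
  by move=> Dx Dy; apply: pfun_dom; [exact: NA|apply: pfun_dom; exact: baseA].
pose hh x := if pselect (A x) is left Ax then val (h (SigSub (mem_set Ax))) else x.
have hhB x : A x -> B (hh x).
  by rewrite /hh => Ax; case: pselect => // Ax'; exists (SigSub (mem_set Ax')).
have hh_inj x y : A x -> A y -> hh x = hh y -> x = y.
  rewrite /hh => Ax Ay; case: pselect => // Ax'; case: pselect => // Ay'.
  by move=> /val_inj/hinj/(congr1 val).
pose D := A `|` B.
pose g x y := if pselect (A x /\ A y) then pfun p x y else hh (code x y).
have DN n : D (N n) by left.
have Dg x y : D x -> D y -> D (g x y).
  move=> Dx Dy; rewrite /g; case: pselect => /= [[Ax Ay]|_]; first by left; exact: pfun_dom.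
  by right; apply: hhB; exact: codeA.
have ginj x y x' y' : D x -> D y -> D x' -> D y' -> g x y = g x' y' ->
    x = x' /\ y = y'.
  move=> Dx Dy Dx' Dy'; rewrite /g.
  case: (pselect (A x /\ A y)) => /= [[Ax Ay]|nA];
    case: pselect => /= [[Ax' Ay']|nA'].
  - exact: pfun_inj.
  - move=> e; have /BA[] : B (pfun p x y) by rewrite e; apply: hhB; exact: codeA.
    exact: pfun_dom.
  - move=> e; have /BA[] : B (pfun p x' y') by rewrite -e; apply: hhB; exact: codeA.
    exact: pfun_dom.
  move=> /(hh_inj _ _ (codeA _ _ Dx Dy) (codeA _ _ Dx' Dy')) /pfun_inj[].
  - exact: NA.
  - by apply: pfun_dom; exact: baseA.
  - exact: NA.
  - by apply: pfun_dom; exact: baseA.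
  move=> /tag_inj[Axx' Ayy'] /pfun_inj[]; try exact: baseA.
  by move=> ex ey; split; exact: base_inj.
have /maxp/asboolP[DA _] : pairing_le p (Pairing DN Dg ginj).
  apply/asboolP; split=> [x Ax|x y Ax Ay] /=; first by left.
  by rewrite /g; case: pselect => // -[].
have : B (val (h a0)) by exists a0.
by move=> Bh; apply: (BA _ Bh); apply: DA; right.
Qed.
End PairingFunction.

Lemma card_square (T : Type) : infinite_set [set: T] ->
  exists f : T * T -> T, injective f.
Proof. by move=> /infinite_natP[N Ninj]; exact: pairing_injection Ninj. Qed.

Lemma card_prod_le (T U V : Type) : infinite_set [set: T] ->
  [set: U] #<= [set: T] -> [set: V] #<= [set: T] -> [set: U * V] #<= [set: T].
Proof.
move=> /card_square[f finj] /card_leTP[g ginj] /card_leTP[h hinj].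
apply/card_leTP; exists (fun x => f (g x.1, h x.2)) => -[x y] [x' y'] /=.
by move=> /finj[/ginj -> /hinj ->].
Qed.

(** Folding an injection of T * T into T along a sequence is injective on
    sequences of a given length, so it suffices to record the length too. *)
Lemma card_seq_le (T : Type) : infinite_set [set: T] -> [set: seq T] #<= [set: T].
Proof.
move=> Tinf; have [f finj] := card_square Tinf.
have [N _] := (infinite_natP _).1 Tinf.
have : [set: nat * T] #<= [set: T].
  by apply: card_prod_le => //; apply/infiniteP.
apply: card_le_trans; apply/card_leTP.
exists (fun s => (size s, foldr (fun x a => f (x, a)) (N 0) s)).
elim=> [|x s IH] [|y t]//= [] st /finj[<- e].
by rewrite (IH t)// st e.
Qed.

Lemma card_bigcup_le (T V : Type) (F : nat -> set V) :
  infinite_set [set: T] -> (forall k, F k #<= [set: T]) ->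
  \bigcup_k F k #<= [set: T].
Proof.
move=> Tinf FT; have [N _] := (infinite_natP _).1 Tinf.
have : [set: nat * T] #<= [set: T] by apply: card_prod_le => //; apply/infiniteP.
apply: card_le_trans.
have {}FT k := cid ((card_le_funP (F k) (N 0)).1 (FT k)).
apply/(card_le_funP _ (0, N 0)).
pose k x := if pselect ((\bigcup_k F k) x) is left h then sval (cid2 h) else 0.
have kP x : (\bigcup_k F k) x -> F (k x) x.
  by move=> Fx; rewrite /k; case: pselect => // h; case: (cid2 h).
exists (fun x => (k x, sval (FT (k x)) x)) => x y /kP Fx /kP Fy [kxy].
rewrite -kxy in Fy * => e; exact: (svalP (FT (k x)) _ _ Fx Fy e).
Qed.

Lemma card_set_nle (T : Type) : ~ ([set: set T] #<= [set: T]).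
Proof.
move=> /card_leTP[f finj].
pose D : set T := [set x | exists2 A, f A = x & ~ A x].
have [[A /finj -> nD]|h] := pselect (D (f D)); first by apply: (nD); exists D.
by apply: (h); exists D.
Qed.

Lemma card_le_set (T : Type) : [set: T] #<= [set: set T].
Proof.
apply/card_leTP; exists (fun x => [set x]) => x y e.
by have : [set x] x by []; rewrite e.
Qed.

(** GCH leaves no cardinal strictly between that of T and that of its power set. *)
Lemma gch_below_set (T U : Type) : GCH -> infinite_set [set: T] ->
  ~ ([set: set T] #<= [set: U]) -> [set: U] #<= [set: T].
Proof.
move=> gch Tinf nTU; have [//|TU] := card_le_total U T.
have [e|e] := gch T U Tinf TU (card_nle_ge nTU).
  by move: e; rewrite card_eq_le => /andP[].
by case: nTU; move: e; rewrite card_eq_le => /andP[].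
Qed.

(** * Initial topologies and the existence of weights *)

Local Open Scope ring_scope.

Section InitialBoxes.
Variables (R : realType) (S : choiceType) (J : Type).

(** Boxes with rational sides, cut out by finitely many coordinates. Encoding a
    box by a sequence lets the same bound serve to count a basis and to split a
    set of functions into countably many pieces. *)
Definition rat_box (f : S -> {ptws J -> R}) (s : seq (J * (rat * rat))) : set S :=
  [set y | all (fun t => ratr t.2.1 < f y t.1 < ratr t.2.2) s].

Lemma rat_box_cat (f : S -> {ptws J -> R}) s t :
  rat_box f (s ++ t) = rat_box f s `&` rat_box f t.
Proof. by apply/seteqP; split=> y; rewrite /rat_box/= all_cat => /andP. Qed.

Lemma eval_initial_continuous (f : S -> {ptws J -> R}) (j : J) :
  continuous ((fun y => f y j) : initial_topology f -> R).
Proof.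
move=> y; apply: (@continuous_comp (initial_topology f) {ptws J -> R} R f
  (fun g : {ptws J -> R} => g j)); first exact: initial_continuous.
exact: (@proj_continuous {classic J} (fun=> R) j).
Qed.

Lemma rat_box_open (f : S -> {ptws J -> R}) s :
  open (rat_box f s : set (initial_topology f)).
Proof.
elim: s => [|[j [a b]] s IH].
  have -> : rat_box f [::] = setT by apply/seteqP; split.
  exact: openT.
have -> : rat_box f ((j, (a, b)) :: s) = ((fun y => f y j) @^-1` `]ratr a, ratr b[) `&` rat_box f s.
  by apply/seteqP; split=> y; rewrite /rat_box/= in_itv/= => /andP.
apply: openI => //; apply: (@open_comp (initial_topology f) R).
  by move=> y _; exact: eval_initial_continuous.
exact: interval_open.
Qed.

Lemma rat_box_cvg (f : S -> {ptws J -> R}) (x : initial_topology f) :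
  filter_from [set s | rat_box f s x] (rat_box f) --> x.
Proof.
set F := filter_from _ _.
have FF : Filter F.
  apply: filter_from_filter; first by exists [::].
  move=> s t sx tx; exists (s ++ t); first by rewrite /= rat_box_cat.
  by move=> y; rewrite rat_box_cat.
have cf : f @ F --> f x.
  apply/cvg_sup => j U [_ [[V oV <-] Vx VU]].
  have [e /= e0 eV] : nbhs (f x j) V by exact: open_nbhs_nbhs.
  have /rat_in_itvoo[a] : f x j - e < f x j by rewrite ltrBlDr ltrDl.
  have /rat_in_itvoo[b] : f x j < f x j + e by rewrite ltrDl.
  rewrite !in_itv/= => /andP[xb be] /andP[ea ax].
  exists [:: (j, (a, b))]; first by rewrite /rat_box/= ax xb.
  move=> y; rewrite /rat_box/= andbT => /andP[ay yb].
  apply: VU; apply: eV => /=; rewrite ltr_norml; apply/andP; split; lra.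
move=> U [_ [[V oV <-] Vx VU]]; apply: filterS VU _.
by apply: cf; exact: open_nbhs_nbhs.
Qed.

Lemma rat_box_basis (f : S -> {ptws J -> R}) :
  basis (range (rat_box f) : set (set (initial_topology f))).
Proof.
split=> [_ [s _ <-]|x]; first exact: rat_box_open.
move=> U /rat_box_cvg[s sx sU]; by exists (rat_box f s).
Qed.

Lemma initial_hausdorff (f : S -> {ptws J -> R}) : injective f ->
  hausdorff_space (initial_topology f).
Proof.
move=> finj; rewrite open_hausdorff => x y xy.
have [j fj] : exists j, f x j != f y j.
  apply: contrapT => /forallNP h; move/eqP: xy; apply; apply: finj.
  by apply: funext => j; apply/eqP/negPn/negP; exact: h.
have := @Rhausdorff R; rewrite open_hausdorff => /(_ _ _ fj)[[A B]/=].
rewrite !inE => -[Ax By] [oA oB AB0].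
exists ((fun y => f y j) @^-1` A, (fun y => f y j) @^-1` B); rewrite ?inE//=.
split.
- by apply: (@open_comp (initial_topology f) R) => // z _; exact: eval_initial_continuous.
- by apply: (@open_comp (initial_topology f) R) => // z _; exact: eval_initial_continuous.
by rewrite -preimage_setI AB0 preimage_set0.
Qed.

End InitialBoxes.

(** A weight, being a relation, needs to be shown to exist: it is a basis of
    least cardinality. *)
Lemma weight_exists (Y : topologicalType) : exists K, is_weight Y K.
Proof.
have opB : basis (@open Y).
  split=> // x U; rewrite nbhsE => -[V [oV Vx] VU].
  by exists V.
pose bs := {B : set (set Y) | basis B}.
have [[B bB] /= minB] := @least_card bs (exist _ _ opB) (fun B => sval B : Type).
exists B; split; first by exists B => //; exact: card_setT_sym.
move=> C bC; apply: card_le_trans (minB (exist _ C bC)) _ => /=.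
by rewrite (card_le_eql (card_setT _)).
Qed.

(** The least cardinality is taken over the bases of coarser Tychonoff
    topologies rather than over the topologies, as the type of topologies on X
    lives in a universe that is too large for [least_card]. *)
Lemma iw_exists (X : topologicalType) : tychonoff_space X -> exists I, is_iw X I.
Proof.
move=> tX.
have cX : coarser_tychonoff (Topological.class X).
  by case: X tX => X c tX; split.
have [_ [[B0 bB0 _] _]] :=
  weight_exists (Topological.Pack (Topological.class X)).
pose bs := {B : set (set X) | exists2 c, @coarser_tychonoff X c &
  @basis (Topological.Pack c) B}.
have B0bs : exists2 c, @coarser_tychonoff X c & @basis (Topological.Pack c) B0.
  by exists (Topological.class X).
have [[B [c cc bB]] /= minB] := @least_card bs (exist _ _ B0bs) (fun B => sval B : Type).
have {}minB (C : set (set X)) d : @coarser_tychonoff X d -> @basis (Topological.Pack d) C ->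
    [set: B] #<= C.
  move=> cd bC; have bsC : exists2 c, @coarser_tychonoff X c & @basis (Topological.Pack c) C.
    by exists d.
  apply: card_le_trans (minB (exist _ C bsC)) _ => /=.
  by rewrite (card_le_eql (card_setT _)).
exists B; split.
  exists c => //; split; first by exists B => //; exact: card_setT_sym.
  by move=> C bC; exact: minB cc bC.
move=> d L cd [[C bC CL] _].
by rewrite -(card_le_eqr CL); exact: minB cd bC.
Qed.

(** Every upper bound of the discrete subsets of T is either above T or
    equipotent to a subset of T, so the supremum is found among subsets. *)
Lemma spread_exists (T : topologicalType) : exists S, is_spread T S.
Proof.
pose big := {A : set T | forall D : set T, discrete_subspace D -> D #<= A}.
have bigT : forall D : set T, discrete_subspace D -> D #<= [set: T].
  by move=> D _; exact: card_leT.
have [[A bigA] /= minA] := @least_card big (exist _ _ bigT) (fun A => sval A : Type).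
exists A; split=> [D dD|L bigL].
  by rewrite (card_le_eqr (card_setT _)); exact: bigA.
have [TL|/card_subP[C CL _]] := card_le_total T L.
  by apply: card_le_trans TL; rewrite (card_le_eql (card_setT _)) card_leT.
have bigC (D : set T) : discrete_subspace D -> D #<= C.
  by move=> dD; rewrite (card_le_eqr CL); exact: bigL.
have := minA (exist _ C bigC) => /=.
by rewrite (card_le_eqr (card_setT _)) (card_le_eqr CL).
Qed.

(** The topology induced by a separating family of continuous functions is coarser
    than that of X, is Tychonoff, and has a basis of rational boxes, indexed by
    finite sequences over a set no larger than L. *)
Lemma iw_le_separating (R : realType) (X : topologicalType) (I L J : Type)
    (g : J -> X -> R) :
  is_iw X I -> infinite_set [set: L] -> [set: J] #<= [set: L] ->
  (forall j, continuous (g j)) ->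
  (forall x y, (forall j, g j x = g j y) -> x = y) ->
  [set: I] #<= [set: L].
Proof.
move=> [_ minI] Linf JL gc gsep.
pose f (x : X) : {ptws J -> R} := fun j => g j x.
have finj : injective f.
  by move=> x y e; apply: gsep => j; exact: (congr1 (fun h => h j) e).
pose Y := initial_topology f.
have fc : continuous (f : X -> {ptws J -> R}).
  move=> x; apply/cvg_sup => j U [_ [[V oV <-] Vx VU]].
  apply: filterS VU _; apply: gc; exact: open_nbhs_nbhs.
have cY : @coarser_tychonoff X (Topological.class Y).
  split; first by move=> _ [V oV <-]; apply: open_comp => // x _; exact: fc.
  split; first exact: initial_hausdorff finj.
  exact: (@uniform_completely_regular R Y).
have [K wK] := weight_exists (Topological.Pack (Topological.class Y)).
apply: card_le_trans (minI _ _ cY wK) _.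
apply: card_le_trans (wK.2 _ (rat_box_basis f)) _.
apply: card_le_trans (card_image_le _ _) _.
apply: card_le_trans _ (card_seq_le Linf).
have /card_leTP[e einj] : [set: J * (rat * rat)] #<= [set: L].
  apply: card_prod_le => //; apply: (@card_le_trans _ _ _ [set: nat]).
    by have := card_rat2; rewrite card_eq_le => /andP[].
  exact/infiniteP.
by apply/card_leTP; exists (map e); exact: inj_map.
Qed.

(** * Clopen sets and discrete sets *)

(** A function that depends only on the membership of its argument in finitely
    many clopen sets is locally constant. *)
Lemma clopen_cells_continuous (T U : topologicalType) (J : finType)
    (O : J -> set T) (phi : {set J} -> U) :
  (forall j, clopen (O j)) -> continuous (fun x => phi [set j | x \in O j]%SET).
Proof.
move=> cO x.
have near_cell : \forall y \near x, forall j, (y \in O j) = (x \in O j).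
  apply: filter_forall => j; have [oO clO] := cO j.
  have [xO|xO] := boolP (x \in O j).
    apply: filterS (open_nbhs_nbhs (conj oO (set_mem xO))) => y yO.
    exact: mem_set.
  have oC : open (~` O j) by rewrite openC.
  apply: filterS (open_nbhs_nbhs (conj oC _)) => [y yO|]; last by move=> /mem_set; apply/negP.
  by apply/negbTE/negP => /set_mem.
apply: cvg_near_cst; apply: filterS near_cell => y yx.
by congr phi; apply/setP => j; rewrite !inE.
Qed.

Lemma functionally_open_pos (R : realType) (X : topologicalType) (g : X -> R) :
  continuous g -> functionally_open R [set x | 0 < g x].
Proof.
move=> gc; exists (fun x => Num.max (g x) 0).
  move=> x; have : {for x, continuous ((g : X -> R^o) \max cst 0)}; last exact.
  by apply: continuous_max; [exact: gc|exact: cvg_cst].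
apply/seteqP; split=> x /=; first by move=> gx; rewrite gt_eqF// lt_max gx.
by case: (ltP 0 (g x)) => // g0; rewrite eqxx.
Qed.

(** The sets f < b and a < f form a functionally open cover. In a clopen partition
    refining it, the cells contained in f < b are finitely many, and they cover
    f <= a because the other cells lie in a < f. *)
Lemma clopen_between (R : realType) (X : topologicalType) (f : X -> R) (a b : R) :
  covering_dim0 R X -> continuous f -> a < b ->
  exists C, [/\ clopen C, (forall x, f x <= a -> C x) & (forall x, C x -> f x < b)].
Proof.
move=> dimX fc ab.
pose A := [set x | f x < b]; pose B := [set x | a < f x].
have fA : functionally_open R A.
  rewrite (_ : A = [set x | 0 < b - f x]).
    by apply: functionally_open_pos => x; apply: cvgB; [exact: cvg_cst|exact: fc].
  by apply/seteqP; split=> x; rewrite /A/= subr_gt0.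
have fB : functionally_open R B.
  rewrite (_ : B = [set x | 0 < f x - a]).
    by apply: functionally_open_pos => x; apply: cvgB; [exact: fc|exact: cvg_cst].
  by apply/seteqP; split=> x; rewrite /B/= subr_gt0.
have [|U [->|->]//||VV [finV clV trV covV subV]] := dimX [set A; B].
- exact: finite_set2.
- apply/seteqP; split=> // x _; case: (ltP (f x) b) => fx.
    by exists A => //; left.
  by exists B; [right|exact: lt_le_trans fx].
pose C := \bigcup_(V in [set V | VV V /\ V `<=` A]) V.
have finVA : finite_set [set V | VV V /\ V `<=` A].
  by apply: sub_finite_set finV => V [].
exists C; split.
- split; first by apply: bigcup_open => V [/clV[]].
  by apply: closed_bigcup => // V [/clV[]].
- move=> x fx; have : cover VV id x by rewrite covV.
  move=> [V VVV Vx]; exists V => //; split => //.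
  have [U [->|->]// VU] := subV _ VVV.
  by have := VU _ Vx; rewrite /B/= ltNge fx.
by move=> x [V [_ VA] Vx]; exact: VA Vx.
Qed.

Section ZeroDim.
Variables (R : realType) (X : topologicalType).
Hypotheses (tychX : tychonoff_space X) (dimX : covering_dim0 R X).

Lemma tychonoff_separation (Y : topologicalType) (x : Y) (U : set Y) :
  tychonoff_space Y -> open U -> U x ->
  exists f : Y -> R, [/\ continuous f, f x = 0 & forall y, ~ U y -> f y = 1].
Proof.
move=> [_ crY] oU Ux.
have [f [fc _ f0 f1]] := (@uniform_separatorP Y R _ _).1
  (crY x (~` U) (open_closedC oU) (fun h => h Ux)).
exists f; split=> //; first by apply: (f0 (f x)); exists x.
by move=> y Uy; apply: (f1 (f y)); exists y.
Qed.

Lemma clopen_nbhs (x : X) (U : set X) : open U -> U x ->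
  exists C, [/\ clopen C, C x & C `<=` U].
Proof.
move=> oU Ux; have [f [fc fx fU]] := tychonoff_separation tychX oU Ux.
have [C [cC C0 C1]] := clopen_between dimX fc (@ltr01 R).
exists C; split=> //; first by apply: C0; rewrite fx.
by move=> y /C1 fy; apply: contrapT => /fU; apply/eqP; rewrite lt_eqF.
Qed.

Lemma tychonoff_open_setC1 (Y : topologicalType) (y : Y) : tychonoff_space Y ->
  open (~` [set y]).
Proof.
by move=> [hY _]; rewrite openC; apply: accessible_closed_set1; exact: hausdorff_accessible.
Qed.

Lemma clopen_separation (x y : X) : x <> y ->
  exists C, [/\ clopen C, C x & ~ C y].
Proof.
move=> xy; have [C [cC Cx CU]] := clopen_nbhs (tychonoff_open_setC1 y tychX) xy.
by exists C; split=> // /CU/=; apply.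
Qed.

(** For each pair (U, V) of basic sets that a clopen set of X separates, choose
    such a clopen set. Distinct points are separated by a continuous function,
    and preimages of half lines yield basic sets U and V to which
    [clopen_between] applies; this step rests on covering dimension zero, which
    is stronger than having a clopen basis. *)
Lemma separating_clopens (c : Topological.axioms_ X)
    (B : set (set X)) : coarser_tychonoff c -> @basis (Topological.Pack c) B ->
  exists C : B * B -> set X, (forall p, clopen (C p)) /\
    (forall x y, (forall p, C p x <-> C p y) -> x = y).
Proof.
move=> [co tY] [_ bB]; set Y := Topological.Pack c in co tY bB.
pose good (p : B * B) C := [/\ clopen C, val p.1 `<=` C & val p.2 `<=` ~` C].
have ex p : exists C, clopen C /\ ((exists C', good p C') -> good p C).
  have [[C' gC']|nC] := pselect (exists C', good p C').
    by exists C'; split => //; case: gC'.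
  by exists set0; split=> //; exact: clopen0.
exists (fun p => sval (cid (ex p))); split=> [p|]; first by case: (svalP (cid (ex p))).
move=> x y Cxy; apply: contrapT => xy.
have [f [fc fx fU]] := @tychonoff_separation Y x _ tY (@tychonoff_open_setC1 Y y tY) xy.
have fy : f y = 1 by apply: fU; apply.
have fcX : continuous (f : X -> R).
  apply/continuousP => V oV; apply: co.
  by move/continuousP: fc; exact.
have ab : 3^-1 < 2 / 3 :> R by lra.
have [C [cC C0 C1]] := clopen_between dimX fcX ab.
have oP (V : set R) z : open V -> V (f z) -> exists2 U, (B U /\ U z) & U `<=` f @^-1` V.
  move=> oV Vz; have /bB[U BU UV] : @nbhs Y Y z (f @^-1` V); last by exists U.
  by apply: (@open_nbhs_nbhs Y); split => //; move/continuousP: fc; exact.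
have [U [BU Ux] UV] : exists2 U, (B U /\ U x) & U `<=` f @^-1` `]-oo, 3^-1[.
  apply: oP; first exact: interval_open.
  by rewrite /= in_itv/= fx invr_gt0.
have [W [BW Wy] WV] : exists2 U, (B U /\ U y) & U `<=` f @^-1` `]2/3, +oo[.
  apply: oP; first exact: interval_open.
  rewrite /= in_itv/= fy; lra.
pose p : B * B := (SigSub (mem_set BU), SigSub (mem_set BW)).
have gp : exists C', good p C'.
  exists C; split => //= z.
    by move=> /UV; rewrite /= in_itv/= => /ltW; exact: C0.
  by move=> /WV; rewrite /= in_itv/= andbT => zf /C1; rewrite ltNge ltW.
have [_ /(_ gp)[_ Cx Cy]] := svalP (cid (ex p)).
by apply: (Cy _ Wy); apply/Cxy; exact: Cx.
Qed.

(** X injects into the subsets of the finite index type. *)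
Lemma finite_separating (J : Type) (C : J -> set X) :
  finite_set [set: J] -> (forall x y, (forall j, C j x <-> C j y) -> x = y) ->
  finite_set [set: X].
Proof.
move=> /finite_setP[n]; rewrite card_eq_le => /andP[Jn _] Csep.
have /card_leTP[e einj] : [set: J] #<= [set: 'I_n].
  by apply: card_le_trans Jn _; have := @card_II n; rewrite card_eq_le => /andP[].
apply: (@card_le_finite _ _ _ [set: {set 'I_n}]); last exact: finite_finset.
apply/card_leTP; exists (fun x => [set i | `[< exists2 j, e j = i & C j x >]]%SET).
move=> x y /setP exy; apply: Csep => j.
have := exy (e j); rewrite !inE => h.
have E z : `[< exists2 j', e j' = e j & C j' z >] = `[< C j z >].
  by apply: asbool_equiv_eq; split=> [[j' /einj ->]|Cz]//; exists j.
by move: h; rewrite !E => h; rewrite -(asboolE (C j x)) h asboolE.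
Qed.

End ZeroDim.

Lemma well_founded_order (T : choiceType) : exists lt : T -> T -> Prop,
  well_founded lt /\ (forall x y, [\/ lt x y, x = y | lt y x]).
Proof.
have [le wo] := @well_ordering_principle T.
pose lt x y := le x y /\ x <> y.
have pmin (A : set T) x : A x -> exists2 z, A z & forall y, A y -> le z y.
  move=> Ax; have [|z [[Az zmin] _]] := wo (mem A).
    by exists x; exact: mem_set.
  by exists z; [exact: set_mem|move=> y /mem_set; exact: zmin].
have le_anti x y : le x y -> le y x -> x = y.
  move=> xy yx; have [|z [_ zuniq]] := wo (mem [set x; y]).
    by exists x; apply: mem_set; left.
  have le_refl t : le t t.
    by have [|z' -> /(_ t)] := pmin [set t] t; [|exact].
  have zx : z = x.
    apply: zuniq; split; first by apply: mem_set; left.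
    by move=> t /set_mem[->|->].
  rewrite -zx; apply: zuniq; split; first by apply: mem_set; right.
  by move=> t /set_mem[->|->].
exists lt; split=> [x|x y].
  apply: contrapT => nx; have [z nz zmin] := pmin [set z | ~ Acc lt z] x nx.
  apply: nz; split=> y [yz ynz]; apply: contrapT => /zmin zy.
  by apply: ynz; exact: le_anti.
have [->|/eqP xy] := eqVneq x y; first by apply: Or32.
have [|z [->|->] zmin] := pmin [set x; y] x; first by left.
  by apply: Or31; split=> //; apply: zmin; right.
by apply: Or33; split=> [|/esym//]; apply: zmin; left.
Qed.

(** Shapirovskii's lemma. Along a well-order, y is put into D unless it lies in
    the closure of the earlier points of D or in the neighbourhood U z of such a
    point z. Then U y minus the closure of the earlier points isolates y in D,
    and every rejected y is covered. *)
Lemma shapirovskii (T : topologicalType) (Y : set T) (U : T -> set T) :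
  (forall y, Y y -> open (U y) /\ U y y) ->
  exists D : set T, [/\ D `<=` Y, discrete_subspace D &
    forall y, Y y -> closure D y \/ exists2 z, D z & U z y].
Proof.
move=> YU; have [lt [ltwf lttot]] := well_founded_order T.
pose step (y : T) (rec : forall z, lt z y -> Prop) : Prop :=
  [/\ Y y, ~ closure [set z | exists h : lt z y, rec z h] y &
     forall z (h : lt z y), rec z h -> ~ U z y].
pose D : set T := Fix ltwf (fun=> Prop) step.
have DE y : D y <-> [/\ Y y, ~ closure [set z | lt z y /\ D z] y &
     forall z, lt z y -> D z -> ~ U z y].
  rewrite /D Fix_eq -/D; last first.
    move=> x f g fg; congr step; apply: functional_extensionality_dep => z.
    by apply: functional_extensionality_dep => h; exact: fg.
  rewrite /step; have -> : [set z | exists _ : lt z y, D z] = [set z | lt z y /\ D z].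
    by apply/seteqP; split=> z [h Dz]; [split|exists h].
  by [].
exists D; split.
- by move=> y /DE[].
- move=> y Dy; split; first exact: mem_set.
  have /DE[Yy ncl nU] := Dy; have [oU Uy] := YU _ Yy.
  exists (U y `&` ~` closure [set z | lt z y /\ D z]).
    apply: open_nbhs_nbhs; split; last by split.
    by apply: openI => //; rewrite openC; exact: closed_closure.
  apply/seteqP; split=> [z [[Uyz nclz] Dz]|_ ->] //=.
  have [zy|//|yz] := lttot z y.
    by case: nclz; apply: subset_closure; split.
  by have /DE[_ _ /(_ _ yz Dy)] := Dz.
move=> y Yy; apply: contrapT => /not_orP[ncl nU].
have Dy : D y.
  apply/DE; split=> //; first by apply: contra_not ncl; apply: closureS => z [].
  by move=> z zy Dz Uzy; apply: nU; exists z.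
by apply: ncl; exact: subset_closure.
Qed.

(** In a Hausdorff space a point of the closure of D is determined by the traces
    on D of its neighbourhoods. *)
Lemma card_closure_le (T : topologicalType) (D : set T) : hausdorff_space T ->
  closure D #<= [set: set (set D)].
Proof.
move=> hT; apply/(card_le_funP _ set0).
exists (fun x => [set A | exists2 N, nbhs x N & A = [set d | N (val d)]]).
move=> x y clx cly exy; apply: contrapT => /eqP xy.
move: hT; rewrite open_hausdorff => /(_ _ _ xy)[[A B]/=].
rewrite !inE => -[Ax By] [oA oB AB0].
have [N xN BN] : [set S | exists2 N, nbhs x N & S = [set d : D | N (val d)]]
    [set d | B (val d)].
  rewrite exy; exists B => //; exact: open_nbhs_nbhs.
have [d [Dd [Nd Ad]]] : D `&` (N `&` A) !=set0.
  by apply: clx; apply: filterI => //; exact: open_nbhs_nbhs.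
have : B d by have /seteqP[_ /(_ (SigSub (mem_set Dd)))] := BN; exact.
by move=> Bd; have : (A `&` B) d by []; rewrite AB0.
Qed.

(** * Discrete sets in the powers of X and in C_p(X) *)

(** The indicator functions of clopen sets are continuous. *)
Lemma iw_le_clopens (R : realType) (X : topologicalType) (I L J : Type)
    (C : J -> set X) :
  is_iw X I -> infinite_set [set: L] -> [set: J] #<= [set: L] ->
  (forall j, clopen (C j)) ->
  (forall x y, (forall j, C j x <-> C j y) -> x = y) ->
  [set: I] #<= [set: L].
Proof.
move=> iwI Linf JL cC sepC.
pose g (j : J) (x : X) : R := (tt \in [set k : unit | x \in C j]%SET)%:R.
apply: (@iw_le_separating R X I L J g) => //.
  by move=> j; apply: (@clopen_cells_continuous X R unit (fun=> C j)
    (fun A => (tt \in A)%:R)).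
move=> x y gxy; apply: sepC => j; have := gxy j.
rewrite /g !inE => /eqP; rewrite eqr_nat => exy.
have {}exy : (x \in C j) = (y \in C j).
  by move: exy; case: (x \in C j); case: (y \in C j).
by split=> /mem_set; [rewrite exy|rewrite -exy] => /set_mem.
Qed.

Lemma infinite_set_type (T : Type) (A : set T) :
  infinite_set A -> infinite_set [set: A].
Proof. by move=> /infiniteP infA; apply/infiniteP; rewrite (card_le_eqr (card_setT _)). Qed.

Lemma natr_dist_lt1 (R : realType) (m n : nat) :
  `|m%:R - n%:R : R| < 1 -> m = n.
Proof.
have far (a b : R) : a + 1 <= b -> ~ (`|a - b| < 1).
  by rewrite ltr_norml => ab /andP[lb ub]; lra.
have [mn|nm|//] := ltngtP m n.
  by move=> /far[]; rewrite natr1 ler_nat.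
by rewrite distrC => /far[]; rewrite natr1 ler_nat.
Qed.

Section FunctionSpace.
Variables (R : realType) (X : topologicalType).
Hypotheses (tychX : tychonoff_space X) (dimX : covering_dim0 R X).
Hypothesis (infX : infinite_set [set: X]).

(** A pair of distinct points p has the clopen neighbourhood of all q such that
    W p contains the first but not the second coordinate of q. Applying
    Shapirovskii's lemma to these neighbourhoods gives a discrete set D such that
    the sets W p, for p in the closure of D, separate the points of X; and the
    closure of D has at most as many points as the double power set of D. If D
    were finite, so would be its closure, and then X. *)
Lemma discrete_square : exists D : set {ptws 'I_2 -> X},
  [/\ discrete_subspace D, infinite_set D &
    forall I, is_iw X I -> [set: I] #<= [set: set (set D)]].
Proof.
pose i1 : 'I_2 := ord_max.
have exW (p : {ptws 'I_2 -> X}) : exists C, clopen C /\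
    (p ord0 <> p i1 -> C (p ord0) /\ ~ C (p i1)).
  have [e|ne] := pselect (p ord0 = p i1).
    by exists set0; split=> //; exact: clopen0.
  by have [C [cC C0 C1]] := clopen_separation tychX dimX ne; exists C.
pose W p := sval (cid (exW p)).
have cW p : clopen (W p) by case: (svalP (cid (exW p))).
have sepW p : p ord0 <> p i1 -> W p (p ord0) /\ ~ W p (p i1).
  by case: (svalP (cid (exW p))).
pose Y := [set p : {ptws 'I_2 -> X} | p ord0 <> p i1].
pose U (p : {ptws 'I_2 -> X}) := [set q : {ptws 'I_2 -> X} | W p (q ord0) /\ ~ W p (q i1)].
have [|D [DY discD coverD]] := @shapirovskii {ptws 'I_2 -> X} Y U.
  move=> p Yp; split; last exact: sepW.
  have -> : U p = (fun q => q ord0) @^-1` W p `&` (fun q => q i1) @^-1` ~` W p by [].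
  have pc i : continuous (fun q : {ptws 'I_2 -> X} => q i).
    exact: (@proj_continuous 'I_2 (fun=> X) i).
  apply: openI.
    by apply: open_comp => [q _|]; [exact: pc|exact: (cW p).1].
  apply: open_comp => [q _|]; first exact: pc.
  by rewrite openC; exact: (cW p).2.
have hX2 : hausdorff_space {ptws 'I_2 -> X}.
  by apply: (@hausdorff_product 'I_2 (fun=> X)) => _; exact: tychX.1.
pose C (p : closure D) := W (val p).
have sepC x y : (forall p, C p x <-> C p y) -> x = y.
  move=> Cxy; apply: contrapT => xy.
  pose p : {ptws 'I_2 -> X} := fun i => if i == ord0 then x else y.
  have [clp|[q Dq [Wx Wy]]] := coverD p xy.
    have [Wx] := sepW p xy; apply.
    by apply/(Cxy (SigSub (mem_set clp))).
  apply: Wy; have clq := subset_closure Dq.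
  by apply/(Cxy (SigSub (mem_set clq))).
have infD : infinite_set D.
  move=> finD; apply: infX; apply: (@finite_separating X (closure D) C) => //.
  have -> : closure D = D.
    apply/esym/closure_id; apply: (accessible_finite_set_closed.1 _ _ finD).
    exact: hausdorff_accessible.
  by rewrite (eq_finite_set (card_setT _)).
exists D; split => // I iwI.
apply: (@iw_le_clopens R X I _ (closure D) C) => //.
- have infTD : infinite_set [set: D] by exact: infinite_set_type.
  apply/infiniteP; apply: card_le_trans (card_le_set _).
  by apply: card_le_trans (card_le_set _); exact/infiniteP.
- by rewrite (card_le_eql (card_setT _)); exact: card_closure_le.
- by move=> p; exact: cW.
Qed.

(** If D is the discrete set of [discrete_square] and I is not below D, then I lies
    strictly above D and below its double power set, so that GCH makes I the power
    set of some infinite M. This excludes the limit cardinals, for which a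
    spread might not be attained, or for which countably many smaller cardinals
    might add up to I. *)
Lemma discrete_square_gch (I : Type) : GCH -> is_iw X I ->
  (exists2 D : set {ptws 'I_2 -> X}, discrete_subspace D & [set: I] #<= D) \/
  (exists M : Type, [/\ infinite_set [set: M], ~ ([set: I] #<= [set: M]) &
     forall A : Type, ~ ([set: I] #<= [set: A]) -> [set: A] #<= [set: M]]).
Proof.
move=> gch iwI; have [D [discD infD /(_ _ iwI) ID]] := discrete_square.
have [|nID] := pselect ([set: I] #<= [set: D]).
  by rewrite (card_le_eqr (card_setT _)); left; exists D.
right.
have infTD : infinite_set [set: D] by exact: infinite_set_type.
suff [M infM IM] : exists2 M : Type, infinite_set [set: M] & [set: I] #= [set: set M].
  exists M; split=> // [|A].
    by rewrite (card_le_eql IM); exact: card_set_nle.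
  by rewrite (card_le_eql IM); exact: gch_below_set.
have [I1|I1] := pselect ([set: I] #<= [set: set D]).
  have [e|e] := gch D I infTD (card_nle_ge nID) I1; last by exists D.
  by case: nID; move: e; rewrite card_eq_le => /andP[].
have infsD : infinite_set [set: set D].
  by apply/infiniteP; apply: card_le_trans (card_le_set _); exact/infiniteP.
have [e|e] := gch _ I infsD (card_nle_ge I1) ID; last by exists (set D).
by case: I1; move: e; rewrite card_eq_le => /andP[].
Qed.

(** Isolate each f of F by a rational box, that is by points x_1, ..., x_n and
    rational intervals. Sort F by the sequence of intervals, of which there are
    countably many. Within one class, the tuple of points of f is isolated by the
    preimages under f of the intervals: if the tuple of g lies there, then f lies
    in the box that isolates g. *)
Lemma discrete_Cp_pieces (F : set (Cp R X)) : discrete_subspace F ->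
  exists (n : nat -> nat) (P : nat -> set (Cp R X)), F = \bigcup_k P k /\
    forall k, exists2 D : set {ptws 'I_(n k) -> X}, discrete_subspace D & P k #<= D.
Proof.
move=> discF; have [N _] := (infinite_natP X).1 infX; pose x0 := N 0%N.
pose ev := (fun f : continuousType X R => (f : {ptws X -> R})).
have exs (f : Cp R X) : exists s, F f ->
    rat_box ev s f /\ forall g, F g -> rat_box ev s g -> g = f.
  have [Ff|] := pselect (F f); last by exists [::].
  have [_ [V fV VF]] := discF _ Ff; have [s sf sV] := @rat_box_cvg R _ X ev f V fV.
  exists s => _; split=> // g Fg sg; have /seteqP[/(_ g) VFg _] := VF.
  by apply: VFg; split => //; exact: sV.
pose s f := sval (cid (exs f)).
have sP f : F f -> rat_box ev (s f) f /\ forall g, F g -> rat_box ev (s f) g -> g = f.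
  exact: svalP (cid (exs f)).
pose boxes k : seq (rat * rat) := odflt [::] (unpickle k).
pose n k := size (boxes k).
pose P k := [set f | F f /\ unzip2 (s f) = boxes k].
exists n, P; split.
  apply/seteqP; split=> [f Ff|f [k _ []]//].
  by exists (pickle (unzip2 (s f))) => //; split => //; rewrite /boxes pickleK.
move=> k.
pose pt (f : Cp R X) : {ptws 'I_(n k) -> X} :=
  fun i => (nth (x0, (0, 0)) (s f) i).1.
pose inbox (f : continuousType X R) (y : {ptws 'I_(n k) -> X}) :=
  forall i : 'I_(n k), ratr (nth (0, 0) (boxes k) i).1 < f (y i) <
    ratr (nth (0, 0) (boxes k) i).2.
have inboxP f g : P k g -> rat_box ev (s g) f <-> inbox f (pt g).
  move=> [Fg kg]; have szg : size (s g) = n k by rewrite /n -kg size_map.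
  have nthk i : (i < n k)%N -> (nth (x0, (0, 0)) (s g) i).2 = nth (0, 0) (boxes k) i.
    by move=> ik; rewrite -kg (nth_map (x0, (0, 0))) ?szg.
  split=> [/(all_nthP (x0, (0, 0))) sf i|fg].
    by rewrite -nthk//; apply: sf; rewrite szg.
  apply/(all_nthP (x0, (0, 0))) => i; rewrite szg => ik.
  by have := fg (Ordinal ik); rewrite /= -nthk.
have pt_inj f g : P k f -> P k g -> inbox f (pt g) -> f = g.
  by move=> [Ff _] Pg /(inboxP _ _ Pg); apply: (sP _ Pg.1).2.
exists (pt @` P k).
  move=> _ [f Pf <-]; split; first by apply: mem_set; exists f.
  exists [set y | inbox f y].
    pose cell (i : 'I_(n k)) := [set y : {ptws 'I_(n k) -> X} | ratr (nth (0, 0) (boxes k) i).1 <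
      f (y i) < ratr (nth (0, 0) (boxes k) i).2].
    apply: (@filter_forall _ 'I_(n k) cell (nbhs (pt f)) _) => i.
    have fc : continuous (fun y : {ptws 'I_(n k) -> X} => f (y i)).
      move=> y; apply: (@continuous_comp {ptws 'I_(n k) -> X} X R (fun y => y i) f).
        exact: (@proj_continuous 'I_(n k) (fun=> X) i).
      exact: cts_fun.
    have : open_nbhs (f (pt f i)) `]ratr (nth (0, 0) (boxes k) i).1,
        (ratr (nth (0, 0) (boxes k) i).2 : R)[.
      split; first exact: interval_open.
      by rewrite /= in_itv; exact: ((inboxP f f Pf).1 (sP _ Pf.1).1 i).
    move=> /open_nbhs_nbhs/(fc (pt f)) ptV; apply: (@filterS _ (nbhs (pt f)) _ _ _ _ ptV) => y.
    by rewrite /= in_itv.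
  apply/seteqP; split=> [y [fy [g Pg gy]]|_ ->] /=.
    by move: fy; rewrite -gy => /= /(pt_inj f g Pf Pg) ->.
  split; first exact: ((inboxP f f Pf).1 (sP _ Pf.1).1).
  by exists f.
suff: {in P k &, injective pt} by move=> /inj_card_eq; rewrite card_eq_le => /andP[].
move=> f g /set_mem Pf /set_mem Pg ptfg; apply: pt_inj => //.
rewrite -ptfg; exact: ((inboxP f f Pf).1 (sP _ Pf.1).1).
Qed.

Lemma ptws_box_cvg (n : nat) (d : {ptws 'I_n -> X}) :
  filter_from [set O : 'I_n -> set X | forall i, nbhs (d i) (O i)]
    (fun O => [set y : {ptws 'I_n -> X} | forall i, O i (y i)]) --> d.
Proof.
set G := filter_from _ _.
have FG : Filter G.
  apply: filter_from_filter; first by exists (fun=> setT) => i; exact: filterT.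
  move=> O O' dO dO'; exists (fun i => O i `&` O' i) => [i|y yOO'].
    by apply: filterI.
  by split=> i; case: (yOO' i).
apply/cvg_sup => i U [_ [[V oV <-] Vd VU]].
exists (fun j => if j == i then V else setT).
  move=> j /=; case: eqP => [->|_]; last exact: filterT.
  exact: open_nbhs_nbhs.
by move=> y /(_ i); rewrite eqxx => Vy; exact: VU.
Qed.

(** Choose for each d of D a clopen box O_1 * ... * O_n that isolates d, and let C'
    be a clopen set, such that the sets C' for all d separate points; there
    are enough d for this. The function of d codes by a number the
    set of those i with x in O_i, together with the membership of x in C'. It
    determines C', so the functions separate points. If the function of d' is
    within distance 1 of that of d at all the coordinates d_i, then the codes agree
    there; as d_i lies in the i-th side of the box of d, it lies in the i-th side
    of the box of d' as well, so d lies in the box of d' and d = d'. *)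
Lemma discrete_Cp_of_discrete_power (I : Type) (n : nat) (D : set {ptws 'I_n -> X}) :
  is_iw X I -> discrete_subspace D -> [set: I] #<= D ->
  exists F : set (Cp R X), discrete_subspace F /\ point_separating F.
Proof.
move=> [[c cc [[B bB BI] _]] _] discD ID.
have [C [cC sepC]] := separating_clopens dimX cc bB.
have infB : infinite_set [set: B].
  move=> finB; apply: infX; apply: (@finite_separating X (B * B) C) => //.
  by rewrite -setXTT; exact: finite_setX.
have BD : [set: B] #<= [set: D].
  by rewrite (card_le_eqr (card_setT _)) (card_le_eql (card_setT _)) (card_le_eql BI).
have /card_leTP[e einj] : [set: B * B] #<= [set: D].
  by apply: card_le_trans BD; apply: card_prod_le.
pose C' d := if pselect (exists p, e p = d) is left h then C (sval (cid h)) else set0.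
have C'e p : C' (e p) = C p.
  rewrite /C'; case: pselect => [h|[]]; last by exists p.
  by congr C; apply: einj; exact: svalP (cid h).
have cC' d : clopen (C' d).
  by rewrite /C'; case: pselect => [h|_]; [exact: cC|exact: clopen0].
have ex_box (d : D) : exists O : 'I_n -> set X, (forall i, clopen (O i) /\ O i (val d i)) /\
    forall y, D y -> (forall i, O i (y i)) -> y = val d.
  have [_ [V dV VD]] := discD _ (set_valP d).
  have [N dN NV] := ptws_box_cvg dV.
  have exQ i : exists Q, [/\ clopen Q, Q (val d i) & Q `<=` N i].
    have := dN i; rewrite nbhsE => -[U [oU Ud] UO].
    have [Q [cQ Qd QU]] := clopen_nbhs tychX dimX oU Ud.
    by exists Q; split=> //; exact: subset_trans UO.
  exists (fun i => sval (cid (exQ i))); split=> [i|y Dy Qy].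
    by case: (svalP (cid (exQ i))).
  have : (V `&` D) y.
    by split=> //; apply: NV => i; have [_ _] := svalP (cid (exQ i)); apply.
  by rewrite VD.
pose O d := sval (cid (ex_box d)).
have OP (d : D) : (forall i, clopen (O d i) /\ O d i (val d i)) /\
    forall y, D y -> (forall i, O d i (y i)) -> y = val d := svalP (cid (ex_box d)).
(* The sides of the box of d are indexed by Some i, the set C' d by None. *)
pose cell d (j : option 'I_n) := if j is Some i then O d i else C' d.
have ccell d j : clopen (cell d j).
  by case: j => [i|] /=; [case: ((OP d).1 i)|exact: cC'].
pose code d x : {set option 'I_n} := [set j | x \in cell d j]%SET.
pose phi (A : {set option 'I_n}) : R := (pickle A)%:R.
have phi_inj A A' : `|phi A - phi A'| < 1 -> A = A'.
  by move=> /natr_dist_lt1/(pcan_inj pickleK).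
have fc d : continuous (fun x => phi (code d x)).
  exact: clopen_cells_continuous.
pose f d : continuousType X R := mkcts (fc d).
exists (range f); split.
  move=> _ [d _ <-]; split; first by apply: mem_set; exists d.
  pose near_at i := [set g : Cp R X | `|(g : continuousType X R) (val d i) - f d (val d i)| < 1].
  exists [set g : Cp R X | forall i, near_at i g].
    apply: (@filter_forall _ 'I_n near_at (nbhs (f d : Cp R X)) _) => i.
    have := @eval_initial_continuous R _ X (fun f : continuousType X R => (f : {ptws X -> R})) (val d i) (f d).
    move=> /cvgr_dist_lt/(_ _ ltr01); apply: filterS => g.
    by rewrite /near_at/= distrC.
  apply/seteqP; split=> [g [near_g [d' _ gd]]|_ ->] /=; last first.
    split; last by exists d.
    by move=> i; rewrite /near_at/= subrr normr0.
  rewrite -gd in near_g *; suff -> : d = d' by [].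
  apply/val_inj; apply: ((OP d').2 _ (set_valP d)) => i.
  have /phi_inj/setP/(_ (Some i)) := near_g i.
  by rewrite !inE /= (mem_set ((OP d).1 i).2) => /set_mem.
move=> x y xy.
have [p Cp_] : exists p, ~ (C p x <-> C p y).
  by apply/existsNP => Cxy; move/eqP: xy; apply; exact: sepC.
exists (f (e p)); first by exists (e p).
apply/eqP => /= fxy; apply: Cp_.
have /phi_inj/setP/(_ None) : `|phi (code (e p) x) - phi (code (e p) y)| < 1.
  by rewrite (_ : phi _ = phi (code (e p) y)) ?subrr ?normr0.
rewrite !inE /= C'e => h.
by split=> /mem_set; [rewrite h|rewrite -h] => /set_mem.
Qed.
End FunctionSpace.

Theorem theorem2p14 (R : realType) (X : topologicalType) (gch : GCH)
    (infX : infinite_set [set: X]) (tychX : tychonoff_space X)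
    (dimX : covering_dim0 R X) :
  (exists F : set (Cp R X), discrete_subspace F /\ point_separating F) <->
  (exists (n : nat) (S I : Type),
    [/\ is_spread {ptws 'I_n -> X} S, is_iw X I & [set: I] #<= [set: S]]).
Proof.
split=> [[F [discF sepF]]|[n [S [I [[discS minS] iwI IS]]]]].
  have [I iwI] := iw_exists tychX.
  have [S spS] : exists S : nat -> Type, forall n, is_spread {ptws 'I_n -> X} (S n).
    exists (fun n => sval (cid (spread_exists {ptws 'I_n -> X}))) => n.
    exact: svalP (cid _).
  have [[D discD ID]|[M [infM nIM leM]]] := discrete_square_gch tychX dimX infX gch iwI.
    exists 2%N, (S 2%N), I; split=> //.
    by apply: card_le_trans ID _; exact: (spS 2%N).1.
  apply: contrapT => /forallNP nS; apply: nIM.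
  have SM n : [set: S n] #<= [set: M].
    by apply: leM => ISn; apply: (nS n); exists (S n), I.
  have [n [P [FP PD]]] := discrete_Cp_pieces infX discF.
  have FM : [set: F] #<= [set: M].
    rewrite (card_le_eql (card_setT _)) FP; apply: card_bigcup_le => // k.
    have [D discD PkD] := PD k.
    by apply: card_le_trans PkD _; apply: card_le_trans (SM (n k)); exact: (spS (n k)).1.
  apply: (@iw_le_separating R X I M F (fun f => (val f : continuousType X R))) => //.
    by move=> f; exact: cts_fun.
  move=> x y fxy; apply/eqP/negPn/negP => /sepF[f Ff /eqP]; apply.
  exact: (fxy (SigSub (mem_set Ff))).
have [[D discD ID]|[M [infM nIM leM]]] := discrete_square_gch tychX dimX infX gch iwI.
  exact: (@discrete_Cp_of_discrete_power R X tychX dimX infX I 2 D).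
apply: contrapT => nF; apply: nIM; apply: card_le_trans IS _; apply: minS => D discD.
rewrite -(card_le_eql (card_setT D)); apply: leM => ID; apply: nF.
apply: (@discrete_Cp_of_discrete_power R X tychX dimX infX I n D) => //.
by rewrite -(card_le_eqr (card_setT D)).
Qed.
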